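(* Let $w^d$ be a trajectory of length $T_d$ of the network system $x(t+1)=Ax(t)+Bu(t)$, and let $u:[0,\tau-1]\to\mathbb{R}^m$, $x:[0,\tau-1]\to\mathbb{R}^n$ be arbitrary sequences, with $w=\mathrm{col}(u,x)$ and local signals $w_i^d$, $w_i$ ($i\in\mathcal{V}$) as defined in the context. If for each $i\in\mathcal{V}$ there exists $g_i\in\mathbb{R}^{T_d-\tau+1}$ with $\mathcal{H}_\tau(w_i^d)\,g_i=w_i$, then $w$ is a trajectory of the network system.
   Context: Notation: $[a,b]=\{a,a+1,\dots,b\}$ for integers $a<b$. $\mathrm{col}$ denotes vertical stacking of vectors; for signals defined on the same time interval, $\mathrm{col}(v_1,v_2)(t)=\mathrm{col}(v_1(t),v_2(t))$. A signal $w:[0,\tau-1]\to\mathbb{R}^k$ is identified with the vector $\mathrm{col}(w(0),\dots,w(\tau-1))\in\mathbb{R}^{k\tau}$. For a signal $w:[0,T_d-1]\to\mathbb{R}^k$ and $\tau\le T_d$, the Hankel matrix with $\tau$ block rows, $\mathcal{H}_\tau(w)\in\mathbb{R}^{k\tau\times(T_d-\tau+1)}$, has $(a,b)$ block entry $w(a+b)$, $a\in[0,\tau-1]$, $b\in[0,T_d-\tau]$. Network system: $\mathcal{G}=(\mathcal{V},\mathcal{E})$ is an undirected graph with $\mathcal{V}=[1,N]$, $\mathcal{N}_i=\{j:(i,j)\in\mathcal{E}\}$ are the neighbors of $i$, and $S\subset\mathcal{V}$ is the set of actuated nodes. Node $i$ has state $x_i\in\mathbb{R}^{n_i}$ and,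 if $i\in S$, input $u_i\in\mathbb{R}^{m_i}$. The dynamics are $$x_i(t+1)=A_{ii}x_i(t)+\sum_{j\in\mathcal{N}_i}A_{ij}x_j(t)+B_iu_i(t)\ (i\in S),\qquad x_i(t+1)=A_{ii}x_i(t)+\sum_{j\in\mathcal{N}_i}A_{ij}x_j(t)\ (i\notin S),$$ with $A_{ij}\in\mathbb{R}^{n_i\times n_j}$, $B_i\in\mathbb{R}^{n_i\times m_i}$. Let $x=\mathrm{col}(x_1,\dots,x_N)\in\mathbb{R}^n$, $n=\sum_{i\in\mathcal V} n_i$; let $u\in\mathbb{R}^m$, $m=\sum_{i\in S}m_i$, be the stack of the $u_i$, $i\in S$; in compact form the dynamics read $x(t+1)=Ax(t)+Bu(t)$. A signal $\mathrm{col}(u,x)$ on $[0,L-1]$ is a trajectory if the dynamics hold for all $t\in[0,L-2]$. Data: $u^d:[0,T_d-1]\to\mathbb{R}^m$, $x^d:[0,T_d-1]\to\mathbb{R}^n$ are such that $w^d=\mathrm{col}(u^d,x^d)$ is a trajectory, and $T_d\ge(n+m)\tau-1$. For a set of nodes $\mathcal{N}_i$, $x_{\mathcal{N}_i}$ denotes the stack of the $x_j$, $j\in\mathcal{N}_i$. The local signals are $$w_i^d(t)=\mathrm{col}(u_i^d(t),x^d_{\mathcal{N}_i}(t),x_i^d(t))\ \text{if } i\in S,\qquad w_i^d(t)=\mathrm{col}(x^d_{\mathcal{N}_i}(t),x_i^d(t))\ \text{if } i\notin S,$$ for $t\in[0,T_d-1]$, and analogously $w_i(t)=\mathrm{col}(u_i(t),x_{\mathcal{N}_i}(t),x_i(t))$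 if $i\in S$, $w_i(t)=\mathrm{col}(x_{\mathcal{N}_i}(t),x_i(t))$ if $i\notin S$, for $t\in[0,\tau-1]$. *)

(* Defs.v *)
From HB Require Import structures.
From mathcomp Require Import all_boot all_order all_algebra.
From mathcomp Require Import reals.

Set Implicit Arguments.
Unset Strict Implicit.
Unset Printing Implicit Defensive.

Local Open Scope ring_scope.

(* The actuated nodes are numbered by k : 'I_#|actuated|, number k being the
   node [enum_val k]; input dimensions and input matrices exist only for them.
   Only the blocks [stateMx i i] and [stateMx i j] with j a neighbor of i enter
   the dynamics. *)
Record network (R : realType) := Network {
  nodes : nat;
  edge : rel 'I_nodes;
  edge_sym : symmetric edge;
  actuated : {set 'I_nodes};
  stateDim : 'I_nodes -> nat;
  inputDim : 'I_#|actuated| -> nat;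
  stateMx : forall i j : 'I_nodes, 'M[R]_(stateDim i, stateDim j);
  inputMx : forall k : 'I_#|actuated|,
    'M[R]_(stateDim (enum_val k), inputDim k)
}.

Section Network.
Context {R : realType} (G : network R).

Definition neighbors (i : 'I_(nodes G)) : {set 'I_(nodes G)} :=
  [set j | edge i j].

Definition totalStateDim : nat := (\sum_(i < nodes G) stateDim i)%N.
Definition totalInputDim : nat := (\sum_(k < #|actuated G|) inputDim k)%N.

Definition nodeState (x : 'cV[R]_totalStateDim) (i : 'I_(nodes G)) :
  'cV[R]_(stateDim i) := submxcol x i.

Definition nodeInput (u : 'cV[R]_totalInputDim) (k : 'I_#|actuated G|) :
  'cV[R]_(inputDim k) := submxcol u k.

Definition autonomousPart (x : 'cV[R]_totalStateDim) (i : 'I_(nodes G)) :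
  'cV[R]_(stateDim i) :=
  stateMx i i *m nodeState x i
  + \sum_(j in neighbors i) stateMx i j *m nodeState x j.

(* The pair (t, t') with t' = t + 1 ranges over t in [0, L - 2]. *)
Definition trajectory (L : nat) (u : 'I_L -> 'cV[R]_totalInputDim)
    (x : 'I_L -> 'cV[R]_totalStateDim) : Prop :=
  forall t t' : 'I_L, t' = t.+1 :> nat ->
    (forall k : 'I_#|actuated G|,
       nodeState (x t') (enum_val k)
       = autonomousPart (x t) (enum_val k) + inputMx k *m nodeInput (u t) k)
    /\
    (forall i : 'I_(nodes G), i \notin actuated G ->
       nodeState (x t') i = autonomousPart (x t) i).

Definition neighborDim (i : 'I_(nodes G)) : nat :=
  (\sum_(l < #|neighbors i|) stateDim (enum_val l))%N.

Definition neighborState (x : 'cV[R]_totalStateDim) (i : 'I_(nodes G)) :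
  'cV[R]_(neighborDim i) :=
  \mxcol_(l < #|neighbors i|) nodeState x (enum_val l).

Definition unactuatedLocal (L : nat) (x : 'I_L -> 'cV[R]_totalStateDim)
    (i : 'I_(nodes G)) (t : 'I_L) : 'cV[R]_(neighborDim i + stateDim i) :=
  col_mx (neighborState (x t) i) (nodeState (x t) i).

(* Local signal of the actuated node [enum_val k]. *)
Definition actuatedLocal (L : nat) (u : 'I_L -> 'cV[R]_totalInputDim)
    (x : 'I_L -> 'cV[R]_totalStateDim) (k : 'I_#|actuated G|) (t : 'I_L) :
  'cV[R]_(inputDim k
          + (neighborDim (enum_val k) + stateDim (enum_val k))) :=
  col_mx (nodeInput (u t) k)
         (col_mx (neighborState (x t) (enum_val k))
                 (nodeState (x t) (enum_val k))).

End Network.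

(* The height k L of a stacked signal is written [\sum_(t < L) k], the form
   required by [\mxcol]. *)
Section Hankel.
Context {R : realType} (k : nat).

Definition stackSignal (L : nat) (w : 'I_L -> 'cV[R]_k) :
  'cV[R]_(\sum_(t < L) k) := \mxcol_(t < L) w t.

Lemma hankel_index (tau Td : nat) (le_tau : (tau <= Td)%N)
    (a : 'I_tau) (b : 'I_(Td - tau + 1)) : (a + b < Td)%N.
Proof.
have le_b : (b <= Td - tau)%N by case: b => b /=; rewrite addn1.
by rewrite -[ltnRHS](subnKC le_tau) -addSn leq_add.
Qed.

Definition hankel (tau Td : nat) (le_tau : (tau <= Td)%N)
    (w : 'I_Td -> 'cV[R]_k) : 'M[R]_(\sum_(a < tau) k, Td - tau + 1) :=
  \mxcol_(a < tau) \matrix_(r < k, b < Td - tau + 1)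
    w (Ordinal (hankel_index le_tau a b)) r ord0.

End Hankel.

(* Main.v *)
Require Import Defs.
From HB Require Import structures.
From mathcomp Require Import all_boot all_order all_algebra.
From mathcomp Require Import reals.

Set Implicit Arguments.
Unset Strict Implicit.
Unset Printing Implicit Defensive.

Import GRing.Theory.

Local Open Scope ring_scope.

(** The dynamics of a node relate two consecutive samples of its local signal
by a linear, time-invariant law. Every window of the data satisfies this law,
hence so does every linear combination of windows, that is, every signal in the
image of the local Hankel matrix. Each node may use its own coefficient vector,
because its dynamics involve no signal outside its local one. *)

(** Column [b] of the Hankel matrix is the data window starting at time [b], so [g] holds the
    weights of a combination of windows, read off here at block row [a]. *)
Lemma hankel_mulE (R : realType) (k tau Td : nat) (le_tau : (tau <= Td)%N)
    (wd : 'I_Td -> 'cV[R]_k) (w : 'I_tau -> 'cV[R]_k)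
    (g : 'cV[R]_(Td - tau + 1)) :
  hankel le_tau wd *m g = stackSignal w ->
  forall a, w a = \sum_b g b 0 *: wd (Ordinal (hankel_index le_tau a b)).
Proof.
move=> wE a; have : submxcol (hankel le_tau wd *m g) a = submxcol (stackSignal w) a.
  by rewrite wE.
rewrite /hankel /stackSignal mxcol_mul !mxcolK => <-.
apply/matrixP => r c; rewrite [c]ord1 mxE summxE.
by apply: eq_bigr => b _; rewrite !mxE mulrC.
Qed.

(** Shifting [t] and [t'] by the same [b] keeps them consecutive, so the law holds in each window,
    and the weights [g b 0] do not depend on time. The form with [P] and [Q] covers both kinds of
    node. *)
Lemma hankel_image_law (R : realType) (p k tau Td : nat)
    (le_tau : (tau <= Td)%N) (P Q : 'M[R]_(p, k))
    (wd : 'I_Td -> 'cV[R]_k) (w : 'I_tau -> 'cV[R]_k)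
    (g : 'cV[R]_(Td - tau + 1)) :
  (forall t t' : 'I_Td, t' = t.+1 :> nat -> P *m wd t' = Q *m wd t) ->
  hankel le_tau wd *m g = stackSignal w ->
  forall t t' : 'I_tau, t' = t.+1 :> nat -> P *m w t' = Q *m w t.
Proof.
move=> law /hankel_mulE wE t t' t'E; rewrite !wE !mulmx_sumr.
apply: eq_bigr => b _; rewrite -!scalemxAr; congr (_ *: _).
by apply: law; rewrite /= t'E.
Qed.

Section LocalLaw.
Context {R : realType} (G : network R).

Definition neighborMx (i : 'I_(nodes G)) :
    'M[R]_(stateDim i, neighborDim i) :=
  \mxrow_(l < #|neighbors i|) stateMx i (enum_val l).

Lemma autonomousPartE (x : 'cV[R]_(totalStateDim G)) (i : 'I_(nodes G)) :
  autonomousPart x i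
  = row_mx (neighborMx i) (stateMx i i)
    *m col_mx (neighborState x i) (nodeState x i).
Proof.
rewrite mul_row_col mul_mxrow_mxcol addrC /autonomousPart.
by rewrite [in LHS]big_enum_val.
Qed.

End LocalLaw.

Theorem mainTheorem1 (R : realType) (G : network R) (Td tau : nat)
  (ud : 'I_Td -> 'cV[R]_(totalInputDim G))
  (xd : 'I_Td -> 'cV[R]_(totalStateDim G))
  (wd_traj : trajectory ud xd)
  (le_tau : (tau <= Td)%N)
  (Td_large : ((totalStateDim G + totalInputDim G) * tau - 1 <= Td)%N)
  (u : 'I_tau -> 'cV[R]_(totalInputDim G))
  (x : 'I_tau -> 'cV[R]_(totalStateDim G))
  (H_act : forall k : 'I_#|actuated G|,
     exists g : 'cV[R]_(Td - tau + 1),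
       hankel le_tau (actuatedLocal ud xd k) *m g
       = stackSignal (actuatedLocal u x k))
  (H_unact : forall i : 'I_(nodes G), i \notin actuated G ->
     exists g : 'cV[R]_(Td - tau + 1),
       hankel le_tau (unactuatedLocal xd i) *m g
       = stackSignal (unactuatedLocal x i)) :
  trajectory u x.
Proof.
move=> t t' t'E; split=> [k | i iNS].
- have [g wE] := H_act k; set i := enum_val k.
  (* [P] extracts the node's own state from its local signal; [Q] computes the successor state. *)
  pose P : 'M[R]_(stateDim i, inputDim k + (neighborDim i + stateDim i)) :=
    row_mx 0 (row_mx 0 1%:M).
  pose Q := row_mx (inputMx k) (row_mx (neighborMx i) (stateMx i i)).
  have PE L u' x' (s : 'I_L) :
      P *m actuatedLocal u' x' k s = nodeState (x' s) i.
    by rewrite !mul_row_col !mul0mx mul1mx !add0r.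
  have QE L u' x' (s : 'I_L) :
      Q *m actuatedLocal u' x' k s
      = autonomousPart (x' s) i + inputMx k *m nodeInput (u' s) k.
    by rewrite mul_row_col -autonomousPartE addrC.
  (* The state alone does not determine the input block that [P] annihilates, so [u] is supplied
     explicitly. *)
  rewrite -(PE _ u) -QE; apply: hankel_image_law wE _ _ t'E => s s' s'E.
  by rewrite PE QE; apply: (wd_traj _ _ s'E).1.
- have [g wE] := H_unact i iNS.
  pose P : 'M[R]_(stateDim i, neighborDim i + stateDim i) := row_mx 0 1%:M.
  have PE L x' (s : 'I_L) :
      P *m unactuatedLocal x' i s = nodeState (x' s) i.
    by rewrite mul_row_col mul0mx mul1mx add0r.
  (* Without an input block, the role of [Q] is played by the row matrix of [autonomousPartE]. *)
  rewrite -PE autonomousPartE; apply: hankel_image_law wE _ _ t'E => s s' s'E.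
  by rewrite PE -autonomousPartE; apply: (wd_traj _ _ s'E).2.
Qed.
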